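(* Let $n\ge1$, $m\in\mathbb Z_+^n$, and let $c_\alpha\in\mathbb C$ for $0\le\alpha\le m$ with $c_m\ne0$ (and $c_\alpha=0$ otherwise). Let $X_0=\{\tau\in\mathbb Z^n:\tau\ge0,\ \tau\not\ge m\}$, $\varphi:X_0\to\mathbb C$, and let $f:\mathbb Z_+^n\to\mathbb C$ be the solution of $\sum_{0\le\alpha\le m}c_\alpha f(x+\alpha)=0$ ($x\in\mathbb Z_+^n$), $f=\varphi$ on $X_0$. Assume the generating function $F(z)=\sum_{x\ge0}f(x)/z^{x+I}$ converges in some neighborhood of infinity. Then $F(z)$ is a rational function if and only if the generating function of the initial data $\Phi(z)=\sum_{\tau\in X_0}\varphi(\tau)/z^{\tau+I}$ is a rational function.
   Context: $x\le y$ is componentwise; $\tau\not\ge m$ means $\tau_k<m_k$ for some $k$; $I=(1,\dots,1)$; $z^x=\prod z_k^{x_k}$. The condition $c_m\ne0$ expresses that $m$ belongs to the set of shifts occurring in the equation; under it the Cauchy problem has a unique solution. *)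

(* Defs.v *)
From HB Require Import structures.
From mathcomp Require Import all_boot all_order all_algebra.
From mathcomp Require Import mpoly.
From mathcomp Require Import all_classical all_reals all_analysis.
From mathcomp Require Import complex.
Import Order.TTheory GRing.Theory Num.Theory numFieldNormedType.Exports.

Set Implicit Arguments.
Unset Strict Implicit.
Unset Printing Implicit Defensive.

Local Open Scope ring_scope.

(* The usual (norm-induced) topology on C = R[i], so that limits make sense. *)
HB.instance Definition _ (R : rcfType) := NormedModule.copy R[i] (R[i])^o.

Section Defs.
Variables (R : realType) (n : nat).
Local Notation C := R[i].
Local Notation idx := ('I_n -> nat).

Definition mle (x y : idx) : bool := [forall i, (x i <= y i)%N].

Definition X0 (m : idx) (tau : idx) : bool := ~~ mle m tau.

Definition boxsum (N : nat) (F : idx -> C) : C :=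
  \sum_(a : {ffun 'I_n -> 'I_N.+1}) F (fun i => nat_of_ord (a i)).

Definition sum_le (m : idx) (F : idx -> C) : C :=
  \sum_(a : {ffun 'I_n -> 'I_(\max_(i < n) m i).+1} |
          mle (fun i => nat_of_ord (a i)) m) F (fun i => nat_of_ord (a i)).

Definition zpowI (z : 'I_n -> C) (x : idx) : C := \prod_(k < n) z k ^+ (x k).+1.

Definition gterm (g : idx -> C) (z : 'I_n -> C) (x : idx) : C := g x / zpowI z x.

Definition gf_converges (g : idx -> C) (z : 'I_n -> C) : Prop :=
  exists M : C, forall N, boxsum N (fun x => `|gterm g z x|) <= M.

Definition gf_converges_near_infty (g : idx -> C) : Prop :=
  exists rho : R, forall z : 'I_n -> C,
    (forall k, (rho%:C)%C < `|z k|) -> gf_converges g z.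

(* value of the generating function: limit of the cube partial sums
   (equal to the sum of the series wherever it converges absolutely) *)
Definition genfun (g : idx -> C) (z : 'I_n -> C) : C :=
  limn (fun N => boxsum N (gterm g z)).

(* G coincides near infinity with a rational function P/Q, Q a nonzero
   polynomial in z_1..z_n (written without division: Q*G = P) *)
Definition rational_near_infty (G : ('I_n -> C) -> C) : Prop :=
  exists (rho : R) (P Q : mpoly.mpoly n C), Q != 0 /\
    forall z : 'I_n -> C, (forall k, (rho%:C)%C < `|z k|) ->
      mpoly.meval z Q * G z = mpoly.meval z P.

End Defs.

(* Main.v *)
Require Import Defs.
From HB Require Import structures.
From mathcomp Require Import all_boot all_order all_algebra.
From mathcomp Require Import mpoly.
From mathcomp Require Import all_classical all_reals all_analysis.
From mathcomp Require Import complex.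
From mathcomp Require Import ring.
Import Order.TTheory GRing.Theory Num.Theory numFieldNormedType.Exports.

Set Implicit Arguments.
Unset Strict Implicit.
Unset Printing Implicit Defensive.

Local Open Scope ring_scope.

(* Multiplying F by the characteristic polynomial P(z) = sum c_alpha z^alpha, the
   recurrence cancels everything except boundary terms: near infinity
   P F = sum_alpha c_alpha z^alpha (Phi - Phi_{>= alpha}), where G_{>= alpha} keeps
   only the terms of G with index >= alpha.  Since also Phi = F - F_{>= m}, both
   directions reduce to the fact that truncation G |-> G_{>= alpha} preserves
   rationality.  This is done one variable and one power at a time: if Q G = P
   and G starts with the power z_k^-(a+1), comparing leading coefficients as
   z_k -> oo shows that the z_k^-(a+1)-slice of G is again a quotient of
   polynomials. *)

(** * Coefficients of polynomials with respect to one variable *)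

(** Division-free form of [p(t) / t^d = p_d + O(1/t)]: for [|t| >= 1] each lower term [p_i t^i],
    multiplied by one more [|t|], is still at most [|p_i| |t|^d]. *)
Lemma poly_lead_approx (K : numFieldType) (p : {poly K}) (d : nat) :
  (size p <= d.+1)%N ->
  exists2 L, 0 <= L & forall t, 1 <= `|t| ->
    `|p.[t] - p`_d * t ^+ d| * `|t| <= L * `|t| ^+ d.
Proof.
move=> sp; exists (\sum_(i < d) `|p`_i|); first by rewrite sumr_ge0.
move=> t t1; rewrite (horner_coef_wide _ sp) big_ord_recr /= addrK.
apply: (@le_trans _ _ (\sum_(i < d) `|p`_i * t ^+ i| * `|t|)).
  by rewrite -mulr_suml ler_wpM2r // ler_norm_sum.
rewrite mulr_suml ler_sum // => i _; rewrite normrM normrX -mulrA -exprSr.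
by rewrite ler_wpM2l // ler_weXn2l.
Qed.

(** If [p] had degree [s >= d], its leading term would dominate: the hypothesis and
    [poly_lead_approx] give [|p_s| t <= M + L] for all large real [t], which is absurd. So the
    degree is below [d]. *)
Lemma coef_eq0_of_decay (K : numFieldType) (p : {poly K}) (d : nat) (t0 M : K) :
  0 <= t0 -> 0 <= M ->
  (forall t, t0 <= `|t| -> `|p.[t]| * `|t| <= M * `|t| ^+ d) -> p`_d = 0.
Proof.
move=> t0ge M0 hp; apply/eqP; case: (leqP (size p) d) => [/leq_sizeP->//|dp].
set s := (size p).-1; have sE : size p = s.+1 by rewrite prednK // (leq_trans _ dp).
have [|L L0 hL] := @poly_lead_approx _ p s; first by rewrite sE.
have lc0 : p`_s != 0 by rewrite -lead_coefE lead_coef_eq0 -size_poly_gt0 sE.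
have ds : (d <= s)%N by rewrite -ltnS -sE.
have a0 : 0 < `|p`_s| by rewrite normr_gt0.
(* This choice makes [|p_s| t] equal to [|p_s| (t0 + 1) + (M + L)], strictly above [M + L], while
   [t] is at least both [t0] and 1. *)
pose t := t0 + 1 + (M + L) / `|p`_s|.
have q0 : 0 <= (M + L) / `|p`_s| by rewrite divr_ge0 ?addr_ge0.
have t1 : 1 <= t by rewrite /t -addrA addrCA lerDl addr_ge0.
have tE : `|t| = t by rewrite ger0_norm // (le_trans _ t1).
have tt0 : t0 <= `|t| by rewrite tE /t -addrA lerDl addr_ge0.
have tp : 0 < t by rewrite (lt_le_trans _ t1).
have le1 := hp t tt0; have le2 := hL t; rewrite tE in le1 le2.
have {}le2 := le2 t1.
suff : `|p`_s| * t <= M + L.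
  rewrite /t mulrDr [X in _ + X]mulrC divfK; last by rewrite gt_eqF.
  by rewrite gerDr pmulr_rle0 // lt_geF // ltr_wpDl.
rewrite -(ler_pM2r (exprn_gt0 s tp)) mulrAC mulrDl.
have -> : `|p`_s| * t ^+ s * t = `|p`_s * t ^+ s| * t.
  by rewrite normrM normrX tE.
have -> : p`_s * t ^+ s = p.[t] - (p.[t] - p`_s * t ^+ s) by rewrite subKr.
apply: (@le_trans _ _ ((`|p.[t]| + `|p.[t] - p`_s * t ^+ s|) * t)).
  by rewrite ler_wpM2r ?(ltW tp) // ler_normB.
rewrite mulrDl lerD // (le_trans le1) // ler_wpM2l // ler_weXn2l //.
Qed.

Section CoefInVariable.
Variables (K : fieldType) (n : nat) (k : 'I_n).
Implicit Types (P : {mpoly K[n]}) (z : 'I_n -> K) (j : nat) (t : K).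

Definition updz z t : 'I_n -> K := fun i => if i == k then t else z i.

Definition monless (mu : 'X_{1..n}) : 'X_{1..n} :=
  [multinom (if i == k then 0%N else mu i) | i < n].

(** The coefficient of [X_k^j], kept in the same ring although it is free of [X_k], so that it can
    serve as numerator or denominator of a rational function of all variables. *)
Definition mcoefk P j : {mpoly K[n]} :=
  \sum_(mu <- msupp P | mu k == j) P@_mu *: 'X_[monless mu].

(** [P] as a one-variable polynomial in [X_k], the other variables frozen at [z]; the value [z k]
    does not enter. *)
Definition upoly P z : {poly K} :=
  \sum_(mu <- msupp P) (P@_mu * 'X_[monless mu].@[z]) *: 'X^(mu k).

Definition degk P : nat := \max_(mu <- msupp P) mu k.

Lemma meval_updz_mon z t (mu : 'X_{1..n}) :
  'X_[mu].@[updz z t] = 'X_[monless mu].@[z] * t ^+ mu k.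
Proof.
rewrite !mevalX (bigD1 k) //= [in RHS](bigD1 k) //= mnmE eqxx expr0 mul1r.
rewrite /updz eqxx mulrC; congr (_ * _); apply: eq_bigr => i ik.
by rewrite mnmE (negPf ik).
Qed.

Lemma horner_upoly P z t : (upoly P z).[t] = P.@[updz z t].
Proof.
rewrite {2}[P]mpolyE raddf_sum /= horner_sum; apply: eq_bigr => mu _.
by rewrite hornerZ hornerXn mevalZ meval_updz_mon mulrA.
Qed.

Lemma coef_upoly P z j : (upoly P z)`_j = (mcoefk P j).@[z].
Proof.
rewrite coef_sum raddf_sum /= [RHS]big_mkcond /=; apply: eq_bigr => mu _.
by rewrite coefZ coefXn eq_sym mevalZ; case: eqP; rewrite ?mulr1 ?mulr0.
Qed.

Lemma size_upoly P z : (size (upoly P z) <= (degk P).+1)%N.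
Proof.
apply/leq_sizeP => j dj; rewrite coef_sum big_seq big1 // => mu muP.
rewrite coefZ coefXn eqn_leq [(j <= _)%N]leqNgt (leq_trans _ dj) ?mulr0 //.
by rewrite ltnS /degk; apply: leq_bigmax_seq.
Qed.

(** The maximal exponent is attained at some [mu0]. Monomials with equal [k]-exponent stay distinct
    under [monless], so nothing cancels and [P@_mu0] survives as a coefficient. *)
Lemma mcoefk_degk_neq0 P : P != 0 -> mcoefk P (degk P) != 0.
Proof.
rewrite -msupp_eq0 => P0.
have [mu0 mu0P mu0k] : exists2 mu, mu \in msupp P & mu k = degk P.
  rewrite /degk; case: (msupp P) P0 => // mu s _.
  elim: s mu => [|nu s ih] mu; first by exists mu; rewrite ?inE // big_seq1.
  have [mu' mu's mu'k] := ih nu.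
  rewrite big_cons -mu'k; case: (leqP (mu' k) (mu k)) => _.
    by exists mu => //; rewrite inE eqxx.
  by exists mu' => //; rewrite inE mu's orbT.
move: (mu0P); rewrite mcoeff_msupp; apply: contraNneq => cP0; apply/eqP.
have := congr1 (mcoeff (monless mu0)) cP0.
rewrite mcoeff0 raddf_sum /= -big_filter (bigD1_seq mu0) /=; last 2 first.
- by rewrite mem_filter mu0k eqxx.
- by rewrite filter_uniq // msupp_uniq.
rewrite mcoeffZ mcoeffX eqxx mulr1 big_filter_cond big1 ?addr0; first by move=> ->.
move=> mu /andP[muk mu0']; rewrite mcoeffZ mcoeffX; case: eqP; rewrite ?mulr0 //.
move=> eqm; case/eqP: mu0'; apply/mnmP => i.
have := congr1 (fun x : 'X_{1..n} => x i) eqm; rewrite !mnmE.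
by case: eqP => // -> _; rewrite mu0k; apply/eqP.
Qed.

End CoefInVariable.

(** * Sums over boxes *)

Section BoxSums.
Local Open Scope classical_set_scope.
Local Open Scope ring_scope.
Variables (R : realType) (n : nat).
Local Notation C := (R[i]).
Local Notation Re := (@complex.Re _).
Local Notation Im := (@complex.Im _).
Local Notation idx := ('I_n -> nat).
Implicit Types (h : idx -> C) (N : nat).

(** The translated cube is the box from [al] to [al + N]; an indicator embeds it in a cube of side
    [N + K], so that it can be compared with other cube sums. *)
Lemma boxsum_shift N K (al : idx) h : (forall i, (al i <= K)%N) ->
  boxsum N (fun x => h (fun i => (x i + al i)%N)) =
  boxsum (N + K)
    (fun x => if mle al x && mle x (fun i => (al i + N)%N) then h x else 0).
Proof.
move=> alK; rewrite /boxsum -[RHS]big_mkcond /=.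
pose up (y : {ffun 'I_n -> 'I_N.+1}) : {ffun 'I_n -> 'I_(N + K).+1} :=
  [ffun i => inord (y i + al i)].
pose down (x : {ffun 'I_n -> 'I_(N + K).+1}) : {ffun 'I_n -> 'I_N.+1} :=
  [ffun i => inord (x i - al i)].
have upE y i : up y i = (y i + al i)%N :> nat.
  by rewrite ffunE inordK // ltnS leq_add // -ltnS.
(* Subtraction is truncated, so [down] is a right inverse of [up] only for [x >= al], which the
   filter ensures. *)
rewrite (reindex_onto up down) /=; last first.
  move=> x /andP[/forallP xa /forallP xN]; apply/ffunP => i; apply/val_inj.
  rewrite /= upE ffunE inordK ?subnK ?xa //.
  by rewrite ltnS leq_subLR xN.
apply: eq_big => [y|y _]; last by congr h; apply/funext => i; rewrite upE.
apply/esym/andP; split; last first.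
  apply/eqP/ffunP => i; apply/val_inj.
  by rewrite ffunE /= upE addnK inord_val.
apply/andP; split; apply/forallP => i; rewrite upE ?leq_addl //.
by rewrite addnC leq_add2l -ltnS.
Qed.

Lemma boxsum_widen N K h :
  boxsum N h = boxsum (N + K) (fun x => if mle x (fun=> N) then h x else 0).
Proof.
have := @boxsum_shift N K (fun=> 0%N) h (fun=> leq0n K).
have -> : (fun x : idx => h (fun i => (x i + 0)%N)) = h.
  by apply/funext => x; congr h; apply/funext => i; rewrite addn0.
move=> ->; congr boxsum; apply/funext => x.
by have -> : mle (fun=> 0%N) x by apply/forallP.
Qed.

Lemma boxsumB N h1 h2 :
  boxsum N (fun x => h1 x - h2 x) = boxsum N h1 - boxsum N h2.
Proof. exact: sumrB. Qed.

Lemma boxsumZ N (a : C) h : boxsum N (fun x => a * h x) = a * boxsum N h.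
Proof. by rewrite /boxsum mulr_sumr. Qed.

Lemma ler_boxsum N h1 h2 : (forall x, h1 x <= h2 x) -> boxsum N h1 <= boxsum N h2.
Proof. by move=> h12; apply: ler_sum. Qed.

Lemma ler_norm_boxsum N h : `|boxsum N h| <= boxsum N (fun x => `|h x|).
Proof. exact: ler_norm_sum. Qed.

(** The two sums agree on the small cube, so only points of the large cube outside it contribute,
    and the right-hand side is the absolute sum over exactly those points. *)
Lemma boxsum_tail N K (A : pred idx) h :
  (forall x, mle x (fun=> N) -> A x) ->
  `|boxsum (N + K) (fun x => if A x then h x else 0) - boxsum N h| <=
  boxsum (N + K) (fun x => `|h x|) - boxsum N (fun x => `|h x|).
Proof.
move=> NA; rewrite (boxsum_widen N K h) (boxsum_widen N K (fun x => `|h x|)).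
rewrite -!boxsumB; apply: le_trans (ler_norm_boxsum _ _) _.
apply: ler_boxsum => x; have [/NA->|_] := boolP (mle x _).
  by rewrite !subrr normr0.
by rewrite !subr0; case: ifP => // _; rewrite normr0.
Qed.

(** * Absolute convergence and limits of cube sums *)

Definition abs_bounded h := exists M : C, forall N, boxsum N (fun x => `|h x|) <= M.

Lemma abs_bounded_le h1 h2 :
  (forall x, `|h1 x| <= `|h2 x|) -> abs_bounded h2 -> abs_bounded h1.
Proof.
move=> h12 [M hM]; exists M => N; apply: le_trans (hM N).
exact: ler_boxsum.
Qed.

Lemma abs_boundedZ (a : C) h : abs_bounded h -> abs_bounded (fun x => a * h x).
Proof.
move=> [M hM]; exists (`|a| * M) => N.
rewrite (_ : (fun _ => _) = (fun x => `|a| * `|h x|)).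
  by rewrite boxsumZ ler_wpM2l.
by apply/funext => x; rewrite normrM.
Qed.

(** Both [b] and [u + b] are nondecreasing and bounded above, hence convergent; so is their
    difference [u]. *)
Lemma is_cvgn_of_dist_le (u b : nat -> R) (M : R) :
  (forall N, `|u N.+1 - u N| <= b N.+1 - b N) -> (forall N, b N <= M) -> cvgn u.
Proof.
move=> ub bM.
have bnd : nondecreasing_seq b.
  by apply/nondecreasing_seqP => N; rewrite -subr_ge0 (le_trans _ (ub N)).
have cb : cvgn b.
  by apply: nondecreasing_is_cvgn => //; exists M => _ [N _ <-].
have uleb N : u N - u 0%N <= b N - b 0%N.
  elim: N => [|N ih]; first by rewrite !subrr.
  have := lerD (le_trans (ler_norm _) (ub N)) ih.
  by rewrite !addrA !subrK.
have cub : cvgn (u \+ b).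
  apply: nondecreasing_is_cvgn.
    apply/nondecreasing_seqP => N /=; rewrite -subr_ge0 opprD addrACA.
    have := ub N; rewrite distrC => /(le_trans (ler_norm _)).
    by rewrite -subr_ge0 opprB addrC.
  exists (u 0%N - b 0%N + M + M) => _ [N _ <-] /=; rewrite lerD //.
  by rewrite -lerBlDl opprB addrCA addrC; apply: le_trans (lerD (uleb N) (lexx _)) _;
     rewrite subrK.
have -> : u = (u \+ b) - b by apply/funext => N; rewrite /= [RHS]addrK.
exact: is_cvgB.
Qed.

Lemma abs_bounded_cvg h : abs_bounded h ->
  exists l : C, (fun N => boxsum N h) @ \oo --> l.
Proof.
move=> [M hM]; pose B N := boxsum N (fun x => `|h x|).
have step N : `|boxsum N.+1 h - boxsum N h| <= B N.+1 - B N.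
  by have := @boxsum_tail N 1 xpredT h (fun _ _ => isT); rewrite addn1.
have ReB (x y : C) : Re (x - y) = Re x - Re y by exact: (raddfB (@complex.Re R)).
have ImB (x y : C) : Im (x - y) = Im x - Im y by exact: (raddfB (@complex.Im R)).
have stepR N : Re `|boxsum N.+1 h - boxsum N h| <= Re (B N.+1) - Re (B N).
  by have := step N; rewrite lecE ReB => /andP[].
have BM N : Re (B N) <= Re M by have := hM N; rewrite lecE => /andP[].
have cRe : cvgn (fun N => Re (boxsum N h)).
  apply: (@is_cvgn_of_dist_le _ (fun N => Re (B N)) (Re M)) => // N.
  apply: le_trans (stepR N); rewrite -ReB.
  by have := normc_ge_Re (boxsum N.+1 h - boxsum N h); rewrite lecE => /andP[].
have cIm : cvgn (fun N => Im (boxsum N h)).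
  apply: (@is_cvgn_of_dist_le _ (fun N => Re (B N)) (Re M)) => // N.
  apply: le_trans (stepR N); rewrite -ImB.
  (* Multiplication by [i] keeps the modulus and turns the imaginary part into minus the real part,
     so the bound for real parts applies. *)
  have := normc_ge_Re ((boxsum N.+1 h - boxsum N h) * 'i%C).
  rewrite ReiNIm normrN normrM complexiE normCi mulr1.
  by rewrite lecE => /andP[].
set a := limn (fun N => Re (boxsum N h)) in cRe *.
set b := limn (fun N => Im (boxsum N h)) in cIm *.
exists (a +i* b)%C; apply/cvgrPdist_le => e e0.
have eR : e = (Re e)%:C%C by rewrite RRe_real // gtr0_real.
have e2 : 0 < Re e / 2 by rewrite divr_gt0 // -ltcR -eR.
have /cvgrPdist_le/(_ _ e2) nRe := cRe.
have /cvgrPdist_le/(_ _ e2) nIm := cIm.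
near=> N.
have n1 : `|a - Re (boxsum N h)| <= Re e / 2 by near: N.
have n2 : `|b - Im (boxsum N h)| <= Re e / 2 by near: N.
have nR (x : R) : `|x%:C%C| = `|x|%:C%C.
  by rewrite normc_def /= expr0n addr0 sqrtr_sqr.
set w := _ - boxsum N h.
have wE : w = (a - Re (boxsum N h))%:C%C + 'i%C * (b - Im (boxsum N h))%:C%C.
  by rewrite [LHS]complexE ReB ImB.
rewrite wE (le_trans (ler_normD _ _)) // normrM complexiE normCi mul1r !nR.
by rewrite -rmorphD eR lecR [leRHS]splitr lerD.
Unshelve. all: by end_near. Qed.

(** Since [A N] contains the cube of side [N], the error is at most [B (N + K) - B N], where [B] is
    the convergent sequence of absolute sums; this tends to 0. *)
Lemma boxsum_exhaust_cvg K (A : nat -> pred idx) h (l : C) : abs_bounded h ->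
  (forall N x, mle x (fun=> N) -> A N x) ->
  (fun N => boxsum N h) @ \oo --> l ->
  (fun N => boxsum (N + K) (fun x => if A N x then h x else 0)) @ \oo --> l.
Proof.
move=> bh hA hl; pose B N := boxsum N (fun x => `|h x|).
have [l' Bl'] : exists l' : C, B @ \oo --> l'.
  by apply: abs_bounded_cvg; apply: abs_bounded_le bh => x; rewrite normr_id.
have Bd : (fun N => B (N + K)%N - B N) @ \oo --> (0 : C).
  have BK : (fun N => B (N + K)%N) @ \oo --> l'.
    exact: (cvg_comp _ _ (cvg_addnr K) Bl').
  have BB := @cvgB _ _ _ _ _ _ _ _ _ BK Bl'.
  rewrite subrr in BB.
  exact: BB.
apply/cvgrPdist_le => e e0; have e2 : 0 < e / 2 by rewrite divr_gt0.
move/cvgrPdist_le/(_ _ e2): Bd => Bd; move/cvgrPdist_le/(_ _ e2): hl => hl.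
near=> N; rewrite -(subrKA (boxsum N h)) [leRHS]splitr.
apply: le_trans (ler_normD _ _) (lerD _ _); first by near: N.
rewrite distrC; apply: le_trans (boxsum_tail K h (hA N)) _.
apply: le_trans (real_ler_norm _) _.
  by rewrite realB // ger0_real // sumr_ge0.
by rewrite -normrN -sub0r; near: N.
Unshelve. all: by end_near. Qed.

Definition restr (A : pred idx) (h : idx -> C) : idx -> C :=
  fun x => if A x then h x else 0.

Lemma norm_restr_le (A : pred idx) h x : `|restr A h x| <= `|h x|.
Proof. by rewrite /restr; case: ifP => // _; rewrite normr0. Qed.

(** Cube sums of the translate run over the boxes from [al] to [al + N], which exhaust the points
    above [al] without being cubes based at 0; absolute convergence makes the limit the same. *)
Lemma boxsum_shift_cvg (al : idx) h (l : C) : abs_bounded h ->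
  (fun N => boxsum N (restr (mle al) h)) @ \oo --> l ->
  (fun N => boxsum N (fun x => h (fun i => (x i + al i)%N))) @ \oo --> l.
Proof.
move=> bh hl; pose K := (\max_i al i)%N.
have alK i : (al i <= K)%N by exact: leq_bigmax.
have bh' : abs_bounded (restr (mle al) h).
  exact: abs_bounded_le (norm_restr_le _ _) bh.
have := @boxsum_exhaust_cvg K (fun N x => mle x (fun i => al i + N)%N) _ _ bh' _ hl.
rewrite (_ : (fun N => boxsum (N + K) _) =
  (fun N => boxsum N (fun x => h (fun i => (x i + al i)%N)))).
  apply=> N x /forallP xN; apply/forallP => i.
  exact: leq_trans (xN i) (leq_addl _ _).
apply/funext => N; rewrite (boxsum_shift _ h alK); congr boxsum.
by apply/funext => x; rewrite /restr andbC; case: (mle x _); case: (mle al x).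
Qed.

Lemma norm_boxsum_lim h (l M : C) : 0 <= M ->
  (forall N, `|boxsum N h| <= M) -> (fun N => boxsum N h) @ \oo --> l -> `|l| <= M.
Proof.
move=> M0 hM hl; apply/ler_addgt0Pr => e e0.
move/cvgrPdist_le/(_ _ e0): hl => [N _ /(_ N (leqnn N)) lN].
rewrite -(subrK (boxsum N h) l) addrC (le_trans (ler_normD _ _)) // lerD //.
Qed.

End BoxSums.

(** * Generating functions *)

Lemma inv_eq_of_mul (K : fieldType) (a b p q : K) :
  a != 0 -> b != 0 -> q != 0 -> a * p = b * q -> a^-1 = b^-1 * (p / q).
Proof.
move=> a0 b0 q0 apbq; apply: (mulfI a0); rewrite divff //.
by rewrite mulrCA [a * _]mulrA apbq mulfK // mulVf.
Qed.

Lemma prod_updz (K : fieldType) (n : nat) (k : 'I_n) (z : 'I_n -> K) (t : K)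
    (e : 'I_n -> nat) :
  (\prod_i updz k z t i ^+ e i) * z k ^+ e k = (\prod_i z i ^+ e i) * t ^+ e k.
Proof.
rewrite (bigD1 k) //= [in RHS](bigD1 k) //= {1}/updz eqxx.
rewrite mulrAC [RHS]mulrAC [t ^+ _ * _]mulrC; congr (_ * _).
by apply: eq_bigr => i ik; rewrite /updz (negPf ik).
Qed.

Section GeneratingFunctions.
Local Open Scope classical_set_scope.
Local Open Scope ring_scope.
Variables (R : realType) (n : nat).
Local Notation C := (R[i]).
Local Notation idx := ('I_n -> nat).
Implicit Types (g : idx -> C) (z : 'I_n -> C) (A : pred idx).

(** [genfun] is a [limn], meaningful only once the limit exists; absolute convergence supplies
    it. *)
Lemma genfun_cvg g z : gf_converges g z ->
  (fun N => boxsum N (gterm g z)) @ \oo --> genfun g z.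
Proof. by move=> /abs_bounded_cvg[l hl]; apply: (cvgP _ hl). Qed.

Lemma genfun_unique g z (l : C) :
  (fun N => boxsum N (gterm g z)) @ \oo --> l -> genfun g z = l.
Proof. exact: cvg_lim. Qed.

Lemma gterm_restr A g z : gterm (restr A g) z = restr A (gterm g z).
Proof.
by apply/funext => x; rewrite /gterm /restr; case: ifP => // _; rewrite mul0r.
Qed.

Lemma gf_converges_restr A g z : gf_converges g z -> gf_converges (restr A g) z.
Proof.
rewrite /gf_converges gterm_restr; apply: abs_bounded_le => x.
exact: norm_restr_le.
Qed.

Lemma genfunB g1 g2 z : gf_converges g1 z -> gf_converges g2 z ->
  genfun (fun x => g1 x - g2 x) z = genfun g1 z - genfun g2 z.
Proof.
move=> /genfun_cvg c1 /genfun_cvg c2; apply: genfun_unique.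
rewrite (_ : (fun N => _) =
  (fun N => boxsum N (gterm g1 z)) - (fun N => boxsum N (gterm g2 z))).
  exact: (@cvgB _ _ _ _ _ _ _ _ _ c1 c2).
apply/funext => N; rewrite -[RHS]boxsumB; congr boxsum.
by apply/funext => x; rewrite /gterm mulrBl.
Qed.

Definition zpow z (al : idx) : C := \prod_(i < n) z i ^+ al i.

(** From [1 / z^(x+I) = z^al / z^(x+al+I)]: the shifted sequence has generating function [z^al]
    times the truncation of that of [g]. *)
Lemma genfun_shift_cvg g z (al : idx) : (forall i, z i != 0) ->
  gf_converges g z ->
  (fun N => boxsum N (gterm (fun x => g (fun i => (x i + al i)%N)) z)) @ \oo -->
  zpow z al * genfun (restr (mle al) g) z.
Proof.
move=> z0 cg.
have cr := genfun_cvg (gf_converges_restr (mle al) cg).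
rewrite gterm_restr in cr.
have zal0 : zpow z al != 0 by apply/prodf_neq0 => i _; rewrite expf_neq0.
pose h x := zpow z al * gterm g z x.
rewrite (_ : (fun N => _) = (fun N => boxsum N (fun x => h (fun i => (x i + al i)%N)))).
  apply: boxsum_shift_cvg; first exact: abs_boundedZ.
  rewrite (_ : (fun N => _) =
    (fun N => zpow z al *: boxsum N (restr (mle al) (gterm g z)))).
    exact: (@cvgZl_tmp _ _ _ _ _ _ _ _ cr).
  apply/funext => N; rewrite -[RHS]boxsumZ; congr boxsum.
  by apply/funext => x; rewrite /restr /h; case: ifP => // _; rewrite mulr0.
apply/funext => N; congr boxsum; apply/funext => x; rewrite /h /gterm.
rewrite (_ : zpowI z (fun i => (x i + al i)%N) = zpow z al * zpowI z x).
  by rewrite invfM mulrCA mulVKf.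
rewrite /zpowI /zpow -big_split /=; apply: eq_bigr => i _.
by rewrite -exprD addnS [(al i + _)%N]addnC.
Qed.

(** * Generating functions as one coordinate tends to infinity *)

Lemma gterm_updz k z t g x : (forall i, z i != 0) -> t != 0 ->
  gterm g (updz k z t) x = gterm g z x * (z k / t) ^+ (x k).+1.
Proof.
move=> z0 t0; rewrite /gterm -mulrA; congr (_ * _); rewrite expr_div_n.
apply: inv_eq_of_mul; last exact: prod_updz.
- by apply/prodf_neq0 => i _; rewrite /updz expf_neq0 //; case: ifP.
- by apply/prodf_neq0 => i _; rewrite expf_neq0.
- exact: expf_neq0.
Qed.

(** The term changes by [(z_k / t)^(x_k+1)], of modulus at most [|z_k / t|^a]. The case [a = 0]
    preserves convergence; larger [a] gives decay in [t]. *)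
Lemma norm_gterm_updz_le k z t g x (a : nat) : (forall i, z i != 0) ->
  `|z k| <= `|t| -> (a <= (x k).+1)%N ->
  `|gterm g (updz k z t) x| * `|t| ^+ a <= `|gterm g z x| * `|z k| ^+ a.
Proof.
move=> z0 zt ax; have zk0 : 0 < `|z k| by rewrite normr_gt0.
have t0 : 0 < `|t| by apply: lt_le_trans zt.
have tn0 : t != 0 by rewrite -normr_gt0.
rewrite (gterm_updz k g x z0 tn0).
rewrite normrM normrX [`|z k / t|]normf_div -mulrA ler_wpM2l // -(subnK ax) exprD -mulrA.
rewrite -exprMn divfK ?gt_eqF // ler_piMl ?exprn_ge0 //.
by rewrite exprn_ile1 ?divr_ge0 // ler_pdivrMr // mul1r.
Qed.

Lemma gf_converges_updz k z t g : (forall i, z i != 0) ->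
  `|z k| <= `|t| -> gf_converges g z -> gf_converges g (updz k z t).
Proof.
move=> z0 zt; apply: abs_bounded_le => x.
by have := @norm_gterm_updz_le k z t g x 0 z0 zt isT; rewrite !expr0 !mulr1.
Qed.

(** Every term of the slice carries the same power [z_k^-(a+1)], so multiplying by [z_k^(a+1)]
    removes the dependence on [z_k]. *)
Lemma genfun_slice_updz k z t g (a : nat) : (forall i, z i != 0) -> t != 0 ->
  gf_converges g z -> (forall x, x k != a -> g x = 0) ->
  t ^+ a.+1 * genfun g (updz k z t) = z k ^+ a.+1 * genfun g z.
Proof.
move=> z0 t0 cg ga; apply: (mulfI (expf_neq0 a.+1 (invr_neq0 t0))).
rewrite mulrA -exprMn mulVf // expr1n mul1r; apply: genfun_unique.
rewrite mulrA (_ : (fun N => _) =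
  (fun N => (t^-1 ^+ a.+1 * z k ^+ a.+1) *: boxsum N (gterm g z))).
  exact: (@cvgZl_tmp _ _ _ _ _ _ _ _ (genfun_cvg cg)).
apply/funext => N; rewrite -[RHS]boxsumZ; congr boxsum; apply/funext => x.
have [xa|/ga gx] := eqVneq (x k) a; last by rewrite /gterm gx !mul0r mulr0.
by rewrite (gterm_updz k g x z0 t0) xa exprMn mulrC [z k ^+ _ * _]mulrC.
Qed.

(** Outside the slice [x_k = a] the surviving terms have exponent at least [a+2] in [1/z_k]; after
    multiplication by [t^(a+1)] they leave [O(1/t)], uniformly by absolute convergence at [z]. *)
Lemma genfun_leading k z g (a : nat) : (forall i, z i != 0) ->
  gf_converges g z -> (forall x, (x k < a)%N -> g x = 0) ->
  exists2 M, 0 <= M & forall t, `|z k| <= `|t| ->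
  `|t ^+ a.+1 * genfun g (updz k z t)
    - z k ^+ a.+1 * genfun (restr (fun x => x k == a) g) z| * `|t| <= M.
Proof.
move=> z0 cg ga; have [M hM] := cg.
have M0 : 0 <= M by apply: le_trans (hM 0%N); rewrite sumr_ge0.
exists (M * `|z k| ^+ a.+2) => [|t zt]; first by rewrite mulr_ge0 ?exprn_ge0.
have t0 : t != 0 by rewrite -normr_gt0 (lt_le_trans _ zt) ?normr_gt0.
have cgt := gf_converges_updz z0 zt cg.
set A : pred idx := fun x => x k == a.
(* The constant is rewritten as the slice evaluated at [t], so that the difference becomes one
   generating function [g'] at a single point. *)
rewrite -(@genfun_slice_updz k z t (restr A g) a) //; first last.
- by move=> x; rewrite /restr /A => /negPf->.
- exact: gf_converges_restr.
rewrite -mulrBr -genfunB //; last exact: gf_converges_restr.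
set g' := fun x => _; have cg' : gf_converges g' (updz k z t).
  apply: abs_bounded_le cgt => x; rewrite /gterm !normrM ler_wpM2r //.
  by rewrite /g' /restr; case: ifP => _; rewrite ?subrr ?normr0 ?subr0.
rewrite normrM normrX mulrAC -exprSr mulrC -ler_pdivlMr ?exprn_gt0 ?normr_gt0 //.
apply: norm_boxsum_lim (genfun_cvg cg') => [|N].
  apply: divr_ge0; last exact: exprn_ge0.
  by apply: mulr_ge0 => //; apply: exprn_ge0.
rewrite ler_pdivlMr ?exprn_gt0 ?normr_gt0 //.
apply: (@le_trans _ _ (boxsum N (fun x => `|z k| ^+ a.+2 * `|gterm g z x|))).
  rewrite mulrC -(ger0_norm (exprn_ge0 a.+2 (normr_ge0 t))) -normrM -boxsumZ.
  apply: le_trans (ler_norm_boxsum _ _) _; apply: ler_boxsum => x.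
  rewrite normrM ger0_norm ?exprn_ge0 // mulrC [leRHS]mulrC.
  have [xa|xa|xa] := ltngtP (x k) a.
  - by rewrite /gterm /g' /restr ga // if_same subrr !mul0r normr0 !mul0r.
  - rewrite (_ : gterm g' _ x = gterm g (updz k z t) x).
      exact: norm_gterm_updz_le.
    by rewrite /gterm /g' /restr /A gtn_eqF // subr0.
  - rewrite /gterm /g' /restr /A xa eqxx subrr mul0r normr0 mul0r.
    by rewrite mulr_ge0 ?exprn_ge0.
by rewrite boxsumZ mulrC; apply: ler_wpM2r (hM N); rewrite exprn_ge0.
Qed.

End GeneratingFunctions.

(** * Rational functions near infinity *)

Lemma cross_mulrB (K : comPzRingType) (a b x y : K) :
  a * b * (x - y) = a * x * b - b * y * a.
Proof. by ring. Qed.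

(** Read with [s] as [t^d] and [t] as [t^(a+1)]: both summands on the right are a leading-term error
    times a controlled factor. *)
Lemma leading_identity (K : comPzRingType) (q c s t Q G : K) :
  q * c * s - Q * G * t = - ((Q - q * s) * c + Q * (t * G - c)).
Proof. by ring. Qed.

Section Rationality.
Variables (R : realType) (n : nat).
Local Notation C := (R[i]).
Local Notation idx := ('I_n -> nat).
Implicit Types (g : idx -> C) (z : 'I_n -> C) (G : ('I_n -> C) -> C).

Definition near_infty (P : ('I_n -> C) -> Prop) : Prop :=
  exists rho : R, forall z, (forall k, rho%:C%C < `|z k|) -> P z.

Lemma near_inftyS (P Q : ('I_n -> C) -> Prop) :
  (forall z, P z -> Q z) -> near_infty P -> near_infty Q.
Proof. by move=> PQ [rho hP]; exists rho => z /hP/PQ. Qed.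

Lemma near_infty_and (P Q : ('I_n -> C) -> Prop) :
  near_infty P -> near_infty Q -> near_infty (fun z => P z /\ Q z).
Proof.
move=> [r hr] [s hs]; exists (Num.max r s) => z hz; split.
  by apply: hr => k; apply: le_lt_trans (hz k); rewrite lecR le_max lexx.
by apply: hs => k; apply: le_lt_trans (hz k); rewrite lecR le_max lexx orbT.
Qed.

Lemma near_infty_ge1 : near_infty (fun z => forall k, 1 <= `|z k|).
Proof. by exists 1 => z hz k; apply: ltW. Qed.

Lemma near_infty_neq0 : near_infty (fun z => forall k, z k != 0).
Proof.
apply: near_inftyS near_infty_ge1 => z z1 k.
by rewrite -normr_gt0 (lt_le_trans _ (z1 k)).
Qed.

Lemma rationalP G : rational_near_infty G <->
  exists P Q : {mpoly C[n]}, Q != 0 /\ near_infty (fun z => Q.@[z] * G z = P.@[z]).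
Proof.
split=> [[rho [P [Q [Q0 h]]]]|[P [Q [Q0 [rho h]]]]].
  by exists P, Q; split=> //; exists rho.
by exists rho, P, Q.
Qed.

Lemma rational_ext G1 G2 : near_infty (fun z => G1 z = G2 z) ->
  rational_near_infty G1 -> rational_near_infty G2.
Proof.
move=> e12 /rationalP[P [Q [Q0 h]]]; apply/rationalP; exists P, Q; split=> //.
by apply: near_inftyS (near_infty_and e12 h) => z [<-].
Qed.

Lemma rationalB G1 G2 : rational_near_infty G1 -> rational_near_infty G2 ->
  rational_near_infty (fun z => G1 z - G2 z).
Proof.
move=> /rationalP[P1 [Q1 [Q10 h1]]] /rationalP[P2 [Q2 [Q20 h2]]].
apply/rationalP; exists (P1 * Q2 - P2 * Q1), (Q1 * Q2); rewrite mulf_neq0 //.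
split=> //; apply: near_inftyS (near_infty_and h1 h2) => z [e1 e2].
by rewrite mevalM mevalB !mevalM -e1 -e2 cross_mulrB.
Qed.

Lemma rationalM (p : {mpoly C[n]}) G : rational_near_infty G ->
  rational_near_infty (fun z => p.@[z] * G z).
Proof.
move=> /rationalP[P [Q [Q0 h]]]; apply/rationalP; exists (p * P), Q.
by split=> //; apply: near_inftyS h => z e; rewrite mevalM -e mulrCA.
Qed.

(** Zeros of [p] near infinity do no harm: rationality is stated without division, and [Q * p] is
    again a nonzero polynomial. *)
Lemma rational_div (p : {mpoly C[n]}) G : p != 0 ->
  rational_near_infty (fun z => p.@[z] * G z) -> rational_near_infty G.
Proof.
move=> p0 /rationalP[P [Q [Q0 h]]]; apply/rationalP; exists P, (Q * p).
rewrite mulf_neq0 //; split=> //; apply: near_inftyS h => z <-.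
by rewrite mevalM mulrA.
Qed.

Lemma rational0 : rational_near_infty (fun _ : 'I_n -> C => 0).
Proof.
apply/rationalP; exists 0, 1; rewrite oner_neq0; split=> //.
by exists 0 => z _; rewrite mulr0 meval0.
Qed.

Lemma rational_sum (I : Type) (s : seq I) (P : pred I)
    (G : I -> ('I_n -> C) -> C) :
  (forall i, P i -> rational_near_infty (G i)) ->
  rational_near_infty (fun z => \sum_(i <- s | P i) G i z).
Proof.
move=> rG; elim: s => [|i s ih].
  by apply: rational_ext rational0; exists 0 => z _; rewrite big_nil.
have [Pi|Pi] := boolP (P i); last first.
  by apply: rational_ext ih; exists 0 => z _; rewrite big_cons (negPf Pi).
apply: rational_ext (rationalB (rG i Pi) (rationalB rational0 ih)).
by exists 0 => z _; rewrite big_cons Pi sub0r opprK.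
Qed.

(* Leading coefficient in [z_k] at infinity: if [Q * G = P], [Q] has degree [d]
   in [z_k] and [G ~ c * z_k ^ -(a+1)], then [Q_d * c] is the coefficient of
   [z_k ^ d] in [z_k ^ (a+1) * P]. *)
Lemma rational_leading k g (a : nat) : gf_converges_near_infty g ->
  (forall x, (x k < a)%N -> g x = 0) -> rational_near_infty (genfun g) ->
  rational_near_infty (genfun (restr (fun x => x k == a) g)).
Proof.
move=> cg ga [rho [P [Q [Q0 QG]]]].
pose d := degk k Q; pose q := mcoefk k Q d.
pose P1 := P * 'X_k ^+ a.+1.
apply/rationalP; exists (mcoefk k P1 d), (q * 'X_k ^+ a.+1).
split.
  rewrite mulf_neq0 ?mcoefk_degk_neq0 // expf_neq0 //.
  by rewrite -msupp_eq0 msuppX.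
have cbig : near_infty (fun z => forall k, rho%:C%C < `|z k|) by exists rho.
apply: near_inftyS (near_infty_and cbig (near_infty_and cg near_infty_ge1)).
move=> z [zrho [cz z1]].
have z0 i : z i != 0 by rewrite -normr_gt0 (lt_le_trans _ (z1 i)).
have [M M0 hM] := genfun_leading z0 cz ga.
set c := z k ^+ a.+1 * _ in hM.
rewrite mevalM rmorphXn /= mevalXU -mulrA -/c.
have [L L0 hL] := poly_lead_approx (size_upoly k Q z).
rewrite coef_upoly -/d -/q in hL.
(* The coefficient of degree [d] in [r] is the difference of the two sides to be equated, so it
   suffices that [r(t) = O(t^(d-1))]. *)
pose r := (q.@[z] * c) *: 'X^d - upoly k P1 z.
suff: r`_d = 0.
  by rewrite coefB coefZ coefXn eqxx mulr1 coef_upoly => /eqP; rewrite subr_eq0 => /eqP.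
(* [L |c|] bounds the error in the leading term of [Q]; [(|q| + L) M] combines
   [|Q| <= (|q| + L) |t|^d] with the error [M] in the leading term of the series. *)
apply: (@coef_eq0_of_decay _ r d `|z k| (L * `|c| + (`|q.@[z]| + L) * M)) => //.
  by rewrite addr_ge0 ?mulr_ge0 ?addr_ge0.
move=> t zt; have t1 : 1 <= `|t| by apply: le_trans zt.
have td : 0 <= `|t| ^+ d by rewrite exprn_ge0.
have QGt : Q.@[updz k z t] * genfun g (updz k z t) = P.@[updz k z t].
  apply: QG => i; rewrite /updz; case: eqP => _; last exact: zrho.
  exact: lt_le_trans (zrho k) zt.
have := hL t t1; have := hM t zt; rewrite horner_upoly.
set D := t ^+ a.+1 * _ - c; set E := _ - _ * t ^+ d => hD hE.
have rt : r.[t] = - (E * c + Q.@[updz k z t] * D).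
  rewrite hornerD hornerN hornerZ hornerXn horner_upoly /P1 mevalM rmorphXn /=.
  by rewrite mevalXU {2}/updz eqxx -QGt leading_identity.
rewrite rt normrN (le_trans (ler_wpM2r _ (ler_normD _ _))) //.
rewrite !normrM mulrDl [X in _ <= X]mulrDl lerD //.
  by rewrite mulrAC [leRHS]mulrAC ler_wpM2r.
rewrite -mulrA [leRHS]mulrAC ler_pM //.
rewrite -[Q.@[_]](subrK (q.@[z] * t ^+ d)) -/E (le_trans (ler_normD _ _)) //.
rewrite normrM normrX addrC mulrDl lerD //.
by apply: le_trans hE; rewrite ler_peMr.
Qed.

(** By induction on [a]: the part with [x_k >= a] starts at the power [a+1], so its slice [x_k = a]
    is rational by [rational_leading] and can be subtracted. *)
Lemma rational_restr_ge1 k g (a : nat) : gf_converges_near_infty g ->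
  rational_near_infty (genfun g) ->
  rational_near_infty (genfun (restr (fun x => (a <= x k)%N) g)).
Proof.
move=> cg rg; elim: a => [//|a ih].
have cr : gf_converges_near_infty (restr (fun x => (a <= x k)%N) g).
  by apply: near_inftyS cg => z; apply: gf_converges_restr.
have rr := @rational_leading k _ a cr _ ih.
apply: rational_ext (rationalB ih (rr _)).
  apply: near_inftyS cr => z cz; rewrite -genfunB //; last exact: gf_converges_restr.
  congr genfun; apply/funext => x; rewrite /restr.
  by case: ltngtP; rewrite ?subr0 ?subrr.
by move=> x xa; rewrite /restr leqNgt xa.
Qed.

(** The conditions [al i <= x i] are imposed one coordinate at a time, by induction on a list of
    coordinates. *)
Lemma rational_restr_ge (al : idx) g : gf_converges_near_infty g ->
  rational_near_infty (genfun g) ->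
  rational_near_infty (genfun (restr (mle al) g)).
Proof.
move=> cg rg.
suff h (s : seq 'I_n) : rational_near_infty
    (genfun (restr (fun x => all (fun i => al i <= x i)%N s) g)).
  have := h (enum 'I_n); congr (rational_near_infty (genfun (restr _ g))).
  apply/funext => x; apply/allP/forallP => xa i; last by move=> _; exact: xa.
  by apply: xa; rewrite mem_enum.
elim: s => [//|i s ih].
have cr : gf_converges_near_infty
    (restr (fun x => all (fun i => al i <= x i)%N s) g).
  by apply: near_inftyS cg => z; apply: gf_converges_restr.
have := rational_restr_ge1 i (al i) cr ih.
congr (rational_near_infty (genfun _)); apply/funext => x; rewrite /restr /=.
by case: (al i <= x i)%N.
Qed.

End Rationality.

(** * The recurrence *)

Section Recurrence.
Local Open Scope classical_set_scope.
Local Open Scope ring_scope.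
Variables (R : realType) (n : nat).
Local Notation C := (R[i]).
Local Notation idx := ('I_n -> nat).
Variables (m : idx) (c f : idx -> C).

Definition charpoly : {mpoly C[n]} :=
  \sum_(a : {ffun 'I_n -> 'I_(\max_(i < n) m i).+1} |
      mle (fun i => nat_of_ord (a i)) m)
    c (fun i => nat_of_ord (a i)) *: 'X_[[multinom nat_of_ord (a i) | i < n]].

Lemma meval_charpoly (z : 'I_n -> C) :
  charpoly.@[z] = sum_le m (fun al => c al * zpow z al).
Proof.
rewrite /charpoly raddf_sum; apply: eq_bigr => a _ /=.
by rewrite mevalZ mevalX; congr (_ * _); apply: eq_bigr => i _; rewrite mnmE.
Qed.

(** Distinct indices give distinct monomials, so the coefficient of [z^m] is exactly [c m]. *)
Lemma charpoly_neq0 : c m != 0 -> charpoly != 0.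
Proof.
apply: contraNneq => P0; pose M := (\max_(i < n) m i)%N.
have mM i : (m i < M.+1)%N by rewrite ltnS; apply: leq_bigmax.
pose a0 : {ffun 'I_n -> 'I_M.+1} := [ffun i => Ordinal (mM i)].
have a0E : (fun i => nat_of_ord (a0 i)) = m by apply/funext => i; rewrite ffunE.
have := congr1 (mcoeff [multinom m i | i < n]) P0.
rewrite mcoeff0 raddf_sum /= (bigD1 a0) /=; last first.
  by rewrite a0E; apply/forallP.
rewrite a0E mcoeffZ mcoeffX eqxx mulr1 big1 ?addr0 => [->//|a /andP[_ aa0]].
rewrite mcoeffZ mcoeffX; case: eqP => [eqm|]; last by rewrite mulr0.
case/eqP: aa0; apply/ffunP => i; apply/val_inj => /=.
have := congr1 (fun x : 'X_{1..n} => x i) eqm.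
by rewrite !mnmE ffunE.
Qed.

Hypothesis hrec : forall x : idx,
  sum_le m (fun al => c al * f (fun k => (x k + al k)%N)) = 0.

(** Dividing the recurrence at [x] by [z^(x+I)] and summing over a cube gives exactly 0 for every
    side [N]; the identity is the limit, term by term in the finite sum over [al]. *)
Lemma sum_le_genfun_shift (z : 'I_n -> C) : (forall i, z i != 0) ->
  gf_converges f z ->
  sum_le m (fun al => c al * (zpow z al * genfun (restr (mle al) f) z)) = 0.
Proof.
move=> z0 cf; pose u al N := boxsum N (gterm (fun x => f (fun i => (x i + al i)%N)) z).
have ucvg al : u al @ \oo --> zpow z al * genfun (restr (mle al) f) z.
  exact: genfun_shift_cvg.
have u0 N : sum_le m (fun al => c al * u al N) = 0.
  rewrite /sum_le /u; under eq_bigr do rewrite -boxsumZ /boxsum.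
  rewrite exchange_big /= big1 // => x _.
  under eq_bigr do rewrite /gterm mulrA; rewrite -mulr_suml.
  by have := hrec (fun i => nat_of_ord (x i)); rewrite /sum_le => ->; rewrite mul0r.
have sumcvg (s : seq {ffun 'I_n -> 'I_(\max_(i < n) m i).+1}) (P : pred _)
    (al := fun (a : {ffun 'I_n -> 'I_(\max_(i < n) m i).+1}) i => nat_of_ord (a i)) :
  (fun N => \sum_(a <- s | P a) c (al a) * u (al a) N) @ \oo -->
  \sum_(a <- s | P a) c (al a) * (zpow z (al a) * genfun (restr (mle (al a)) f) z).
  elim: s => [|a s ih].
    rewrite big_nil; rewrite (_ : (fun N => _) = (fun=> 0)); first exact: cvg_cst.
    by apply/funext => N; rewrite big_nil.
  rewrite big_cons; case: ifP => Pa; last first.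
    rewrite (_ : (fun N => _) = (fun N => \sum_(a <- s | P a) c (al a) * u (al a) N)) //.
    by apply/funext => N; rewrite big_cons Pa.
  have cu := @cvgZl_tmp _ _ _ _ eventually_filter (c (al a)) _ _ (ucvg (al a)).
  rewrite (_ : (fun N => _) = (c (al a) \*: u (al a)) +
      (fun N => \sum_(a <- s | P a) c (al a) * u (al a) N)).
    exact: (@cvgD _ _ _ _ _ _ _ _ _ cu ih).
  by apply/funext => N; rewrite big_cons Pa.
have l0 := sumcvg (index_enum _) (fun a => mle (fun i => nat_of_ord (a i)) m).
apply: (@cvg_unique _ (@norm_hausdorff _ C) _ _ _ _ l0).
rewrite (_ : (fun N => _) = (fun=> 0)); first exact: cvg_cst.
apply/funext => N; exact: u0.
Qed.

(** Subtracting the vanishing sum leaves [F - F_{>= al}] in each term. For [al <= m] a point not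
    above [al] is not above [m], hence lies in [X0 m], so [F] may be replaced by [Phi]. *)
Lemma charpoly_genfun (z : 'I_n -> C) (Phi := restr (X0 m) f) :
  (forall i, z i != 0) -> gf_converges f z ->
  charpoly.@[z] * genfun f z =
  sum_le m (fun al => c al * zpow z al * (genfun Phi z - genfun (restr (mle al) Phi) z)).
Proof.
move=> z0 cf; have cPhi : gf_converges Phi z by apply: gf_converges_restr.
rewrite meval_charpoly -[RHS]addr0 -(sum_le_genfun_shift z0 cf) /sum_le.
rewrite mulr_suml -big_split /=; apply: eq_bigr => a am.
set al := fun i => nat_of_ord (a i) in am *.
rewrite mulrA -mulrDr; congr (_ * _); apply/eqP; rewrite -subr_eq; apply/eqP.
rewrite -genfunB //; last exact: gf_converges_restr.
rewrite -genfunB //; last exact: gf_converges_restr.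
congr genfun; apply/funext => x; rewrite /Phi /restr /X0.
have [//|alx] := boolP (mle al x); first by rewrite !subrr.
have [mx|//] := boolP (mle m x); case/negP: alx; apply/forallP => i.
exact: leq_trans (forallP am i) (forallP mx i).
Qed.

End Recurrence.

Theorem theorem3 (R : realType) (n : nat) (hn : (0 < n)%N)
    (m : 'I_n -> nat) (c : ('I_n -> nat) -> R[i])
    (hcm : c m != 0)
    (hc0 : forall alpha, ~~ mle alpha m -> c alpha = 0)
    (phi : ('I_n -> nat) -> R[i]) (f : ('I_n -> nat) -> R[i])
    (hrec : forall x : 'I_n -> nat,
        sum_le m (fun alpha => c alpha * f (fun k => (x k + alpha k)%N)) = 0)
    (hinit : forall tau, X0 m tau -> f tau = phi tau)
    (hconv : gf_converges_near_infty f) :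
  rational_near_infty (genfun f) <->
  rational_near_infty (genfun (fun tau => if X0 m tau then phi tau else 0)).
Proof.
set Phi := fun tau => _.
have PhiE : Phi = restr (X0 m) f.
  by apply/funext => x; rewrite /Phi /restr; case: ifP => // /hinit.
have cPhi : gf_converges_near_infty Phi.
  by rewrite PhiE; apply: near_inftyS hconv => z; apply: gf_converges_restr.
split=> [rf|rPhi].
  (* The initial data are what remains of [f] after removing the points above [m]. *)
  apply: rational_ext (rationalB rf (rational_restr_ge m hconv rf)).
  apply: near_inftyS hconv => z cz; rewrite -genfunB //; last exact: gf_converges_restr.
  rewrite PhiE; congr genfun; apply/funext => x; rewrite /restr /X0.
  by case: (mle m x); rewrite ?subrr ?subr0.
apply: (rational_div (charpoly_neq0 hcm)).
(* Each summand of [charpoly_genfun] is presented as a polynomial value times a difference, the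
   shape expected by [rationalM] and [rationalB]. *)
pose G (a : {ffun 'I_n -> 'I_(\max_(i < n) m i).+1}) (z : 'I_n -> R[i]) : R[i] :=
  (c (fun i => nat_of_ord (a i)) *: 'X_[[multinom nat_of_ord (a i) | i < n]]).@[z]
  * (genfun Phi z - genfun (restr (mle (fun i => nat_of_ord (a i))) Phi) z).
suff rG : rational_near_infty
    (fun z => \sum_(a : {ffun 'I_n -> 'I_(\max_(i < n) m i).+1} |
      mle (fun i => nat_of_ord (a i)) m) G a z).
  apply: rational_ext rG.
  apply: near_inftyS (near_infty_and (near_infty_neq0 R n) hconv) => z [z0 cz].
  rewrite (charpoly_genfun hrec z0 cz) -PhiE; apply: eq_bigr => a _.
  rewrite /G mevalZ mevalX; congr (_ * _ * _).
  by apply: eq_bigr => i _; rewrite mnmE.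
apply: rational_sum => a _; apply/rationalM/rationalB => //.
exact: rational_restr_ge.
Qed.
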